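(* Let $T$ be a set, let $X^*=\{X^*_t\}_{t\in T}$ be the Tawn–Molchanov (TM) process with ECF $\theta$, and let $\mathcal{K}^*\subset[0,\infty)^T$ be the dependency set of $X^*$. Then $$\mathcal{K}^*=\bigcap_{A\in\mathcal{F}(T)\setminus\{\varnothing\}}\Bigl\{x\in[0,\infty)^T:\ \sum_{t\in A}x_t\le\theta(A)\Bigr\}.$$
   Context: $\mathcal{F}(T)$ is the set of finite subsets of $T$. Simple max-stable process: a process $X=\{X_t\}_{t\in T}$ with $\mathbb{P}(X_t\le x)=e^{-1/x}$ for all $t\in T$, $x>0$, such that for every $n\in\mathbb{N}$ and independent copies $X^{(1)},\dots,X^{(n)}$ of $X$ the process $\{\bigvee_{i=1}^nX^{(i)}_t\}_{t\in T}$ has the same law (finite-dimensional distributions) as $\{nX_t\}_{t\in T}$. Extremal coefficient function (ECF) of a simple max-stable process $X$: $\theta:\mathcal{F}(T)\to[0,\infty)$ with $\theta(\varnothing)=0$ and $\theta(A)=-x\log\mathbb{P}(\bigvee_{t\in A}X_t\le x)$ for non-empty finite $A\subset T$ (independent of $x>0$). TM process with ECF $\theta$ (where $\theta$ is the ECF of some simple max-stable process on $T$): the simple max-stable process $X^*$ on $T$ (unique in law; its ECF is again $\theta$) with, for every non-empty finite $M\subset T$ and $x\in(0,\infty)^M$, $$-\log\mathbb{P}(X^*_t\le x_t,\ t\in M)=\sum_{\varnothing\neq L\subset M}\tau^M_L\bigvee_{t\in L}\frac1{x_t},\qquad \tau^M_L=\sum_{I\subset L}(-1)^{|I|+1}\theta\bigl((M\setminus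 L)\cup I\bigr).$$ Stable tail dependence function of $\{X_t\}_{t\in M}$, $M$ non-empty finite: $\ell_M(x)=-\log\mathbb{P}(X_t\le1/x_t,\ t\in M)$, $x\in[0,\infty)^M$ (with $1/0=\infty$). Finite-dimensional dependency set $\mathcal{K}_M$: the largest (with respect to inclusion) compact convex set $\mathcal{K}_M\subset[0,\infty)^M$ with $\ell_M(x)=\sup\{\langle x,y\rangle:y\in\mathcal{K}_M\}$ for all $x\in[0,\infty)^M$, where $\langle x,y\rangle=\sum_{t\in M}x_ty_t$; equivalently $\mathcal{K}_M=\bigcap_{x\in[0,\infty)^M}\{y\in[0,\infty)^M:\langle x,y\rangle\le\ell_M(x)\}$. Dependency set of the process $X$: $\mathcal{K}=\bigcap_{M\in\mathcal{F}(T)\setminus\{\varnothing\}}\mathrm{pr}_M^{-1}(\mathcal{K}_M)\subset[0,\infty)^T$, where $\mathrm{pr}_M:[0,\infty)^T\to[0,\infty)^M$ is the coordinate projection. *)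

(* Defs.v *)
From HB Require Import structures.
From mathcomp Require Export all_boot all_order all_algebra finmap.
From mathcomp Require Export all_classical all_reals all_analysis.
Export Order.TTheory GRing.Theory Num.Theory numFieldNormedType.Exports.

(* MathComp-Analysis; finite subsets of T are elements of {fset T}. Assuming
   T : choiceType loses no generality, since every type is a choiceType under
   the classical axioms of boolp. *)

Set Implicit Arguments.
Unset Strict Implicit.
Unset Printing Implicit Defensive.

Global Open Scope classical_set_scope.
Global Open Scope ring_scope.

(* With I = M finite, W = M -> R and f the coordinate maps, this is the product
   sigma-algebra of R^M. *)
Definition sigma_of (R : realType) (I W : Type) (f : I -> W -> R) :
    set (set W) :=
  <<s \bigcup_(i in [set: I]) preimage_set_system [set: W] (f i) measurable >>.

Definition same_fdd (R : realType) (T : choiceType)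
    (d : measure_display) (Omega : measurableType d) (P : probability Omega R)
    (X : T -> Omega -> R)
    (d' : measure_display) (Omega' : measurableType d')
    (P' : probability Omega' R) (Y : T -> Omega' -> R) : Prop :=
  forall (M : {fset T}) (C : set (M -> R)),
    sigma_of (fun (t : M) (y : M -> R) => y t) C ->
    P [set w | C (fun t : M => X (val t) w)] =
    P' [set w | C (fun t : M => Y (val t) w)].

(* Sub-families are covered by taking E i = setT. *)
Definition independent_processes (R : realType) (T : choiceType)
    (d : measure_display) (Omega : measurableType d) (P : probability Omega R)
    (n : nat) (Y : 'I_n -> T -> {RV P >-> R}) : Prop :=
  forall E : 'I_n -> set Omega,
    (forall i, sigma_of (fun t => Y i t : Omega -> R) (E i)) ->
    P (\bigcap_(i in [set: 'I_n]) E i) = (\prod_(i < n) P (E i))%E.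

(* The independent copies may live on any probability space. *)
Definition simple_max_stable (R : realType) (T : choiceType)
    (d : measure_display) (Omega : measurableType d) (P : probability Omega R)
    (X : T -> {RV P >-> R}) : Prop :=
  (forall (t : T) (x : R), 0 < x ->
     P [set w | X t w <= x] = (expR (- x^-1))%:E) /\
  (forall (n : nat) (d' : measure_display) (Omega' : measurableType d')
          (P' : probability Omega' R) (Y : 'I_n.+1 -> T -> {RV P' >-> R}),
     independent_processes Y ->
     (forall i, same_fdd P' (fun t => Y i t : Omega' -> R)
                         P (fun t => X t : Omega -> R)) ->
     same_fdd P' (fun t w => \big[Num.max/Y ord0 t w]_(i < n.+1) Y i t w)
              P (fun t w => n.+1%:R * X t w)).

(* The logarithm lne is extended-real valued (lne 0 = -oo), so the equations
   below force the probabilities to be positive. *)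
Definition is_ecf (R : realType) (T : choiceType)
    (d : measure_display) (Omega : measurableType d) (P : probability Omega R)
    (X : T -> {RV P >-> R}) (theta : {fset T} -> R) : Prop :=
  theta fset0 = 0 /\
  forall (A : {fset T}), A != fset0 -> forall x : R, 0 < x ->
    ((theta A)%:E =
     - (x%:E * lne (P [set w | \big[maxe/-oo]_(t <- A) (X t w)%:E <= x%:E])))%E.

Definition tau (R : realType) (T : choiceType) (theta : {fset T} -> R)
    (M L : {fset T}) : R :=
  \sum_(I <- fpowerset L)
     (-1) ^+ (#|` I|).+1 * theta ((M `\` L) `|` I)%fset.

(* A point of (0,oo)^M is the restriction to M of some x : T -> R; only the
   values of x on M matter. *)
Definition is_TM_process (R : realType) (T : choiceType)
    (d : measure_display) (Omega : measurableType d) (P : probability Omega R)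
    (X : T -> {RV P >-> R}) (theta : {fset T} -> R) : Prop :=
  simple_max_stable X /\
  forall (M : {fset T}) (x : T -> R), M != fset0 ->
    (forall t, t \in M -> 0 < x t) ->
    (- lne (P [set w | forall t, t \in M -> (X t w <= x t)%R]) =
     (\sum_(L <- fpowerset M | L != fset0)
        tau theta M L * \big[Num.max/0]_(t <- L) (x t)^-1)%R%:E)%E.

(* The inverse is taken in \bar R, where 0^-1 = +oo. *)
Definition stdf (R : realType) (T : choiceType)
    (d : measure_display) (Omega : measurableType d) (P : probability Omega R)
    (X : T -> {RV P >-> R}) (M : {fset T}) (x : M -> R) : \bar R :=
  (- lne (P [set w | forall t : M, (X (val t) w)%:E <= (x t)%:E^-1]))%E.

Definition nonneg_orthant (R : realType) (I : Type) : set (I -> R) :=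
  [set y | forall t, 0 <= y t].

(* K is a compact convex subset of [0,oo)^M with support function stdf X. The
   supremum is taken in \bar R. *)
Definition represents_stdf (R : realType) (T : choiceType)
    (d : measure_display) (Omega : measurableType d) (P : probability Omega R)
    (X : T -> {RV P >-> R}) (M : {fset T}) (K : set (M -> R)) : Prop :=
  [/\ K `<=` @nonneg_orthant R M,
      compact (K : set {ptws M -> R}),
      convex_set K
    & forall x : M -> R, @nonneg_orthant R M x ->
        stdf X x = ereal_sup [set (\sum_(t : M) x t * y t)%:E | y in K]].

(* The largest such K, as a definite description. *)
Definition findim_dependency_set (R : realType) (T : choiceType)
    (d : measure_display) (Omega : measurableType d) (P : probability Omega R)
    (X : T -> {RV P >-> R}) (M : {fset T}) : set (M -> R) :=
  xget set0 [set K | represents_stdf X K /\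
                     forall K', represents_stdf X K' -> K' `<=` K].

Definition coord_proj (R : realType) (T : choiceType) (M : {fset T})
    (y : T -> R) : M -> R := fun t => y (val t).

Definition dependency_set (R : realType) (T : choiceType)
    (d : measure_display) (Omega : measurableType d) (P : probability Omega R)
    (X : T -> {RV P >-> R}) : set (T -> R) :=
  @nonneg_orthant R T `&`
  \bigcap_(M in [set M : {fset T} | M != fset0])
     (@coord_proj R T M @^-1` findim_dependency_set X (M := M)).

(* Main.v *)
Require Import Defs.
From mathcomp Require Import ring lra.

(* Inclusion-exclusion applied to the events [X_t <= 1/u], as u tends to 0,
   shows that tau M L >= 0 for L nonempty, and Moebius inversion gives
   theta A = \sum_(L meets A) tau M L. Hence, for any x >= 0, assigning the mass
   tau M L to a maximizer of x on L yields a point y of the polymatroid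
   {y >= 0 | y(A) <= theta A for all A} with <x, y> = l_M(x). Conversely
   <x, y> <= l_M(x) on the polymatroid, by successively peeling off from x
   multiples of the indicator of its support. The polymatroid thus represents l_M; it is the largest such
   set, because l_M is equal to theta A at the indicator of A. *)

Set Implicit Arguments.
Unset Strict Implicit.
Unset Printing Implicit Defensive.

(** * Moebius inversion between [theta] and the masses [tau] *)

Section Moebius.
Variables (R : realType) (T : choiceType).
Implicit Types (theta : {fset T} -> R) (A B K L M : {fset T}).

(** Each subset avoiding [t] is paired with the one obtained by adjoining [t]. This is the induction
    step for the sums over power sets below. *)
Lemma big_fpowersetU1 (V : nmodType) (t : T) L (g : {fset T} -> V) :
  t \notin L ->
  \sum_(I <- fpowerset (t |` L)%fset) g I =
  \sum_(I <- fpowerset L) (g I + g (t |` I)%fset).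
Proof.
move=> tL; rewrite (big_fsetID _ (fun I : {fset T} => t \notin I)) /= big_split /=.
have tNI (I : {fset T}) : (I `<=` L)%fset -> t \notin I.
  by move=> /fsubsetP IL; apply: contra tL => /IL.
congr (_ + _).
  apply: congr_big => //; congr enum_fset; apply/fsetP => I.
  rewrite !inE /= !fpowersetE.
  have [IL|] := boolP (I `<=` L)%fset.
    by rewrite (fsubset_trans IL) ?fsubsetU1 ?tNI.
  apply: contraNF => /andP[/fsubsetP IL tI].
  apply/fsubsetP => s sI; have := IL s sI; rewrite !inE => /orP[/eqP st|//].
  by rewrite -st sI in tI.
have injU : {in fpowerset L &, injective (fun I : {fset T} => t |` I)%fset}.
  move=> I J; rewrite /= !fpowersetE => /tNI tI /tNI tJ IJ.
  by rewrite -(fsetU1K tI) IJ fsetU1K.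
rewrite -(@big_imfset _ _ _ _ _ imfset_key
  (fun I : {fset T} => t |` I)%fset (mem (fpowerset L)) _ injU) /=.
apply: congr_big => //; congr enum_fset; apply/fsetP => I.
rewrite !inE /= negbK; apply/andP/imfsetP => /=.
  rewrite fpowersetE => -[/fsubsetP IL tI]; exists (I `\ t)%fset.
    rewrite fpowersetE; apply/fsubsetP => s; rewrite !inE => /andP[st /IL].
    by rewrite !inE (negPf st).
  by rewrite fsetD1K.
move=> [J]; rewrite fpowersetE => JL ->; rewrite fset1U1 fpowersetE; split=> //.
exact: fsetUS.
Qed.

(** In the second [tau], the index sets [I] containing [t] restore the arguments of [theta] in
    [tau theta M L] with opposite sign and cancel it; those avoiding [t] give the right-hand
    side. *)
Lemma tauU1 theta M L t : t \in M -> t \notin L ->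
  tau theta M L + tau theta M (t |` L)%fset = tau theta (M `\ t)%fset L.
Proof.
move=> tM tL; rewrite /tau big_fpowersetU1 // big_split /=. rewrite [LHS]addrC -addrA.
rewrite [X in _ + X](_ : _ = 0) ?addr0.
  apply: eq_big_seq => I _; congr (_ * theta (_ `|` _)%fset).
  by rewrite fsetDDl.
rewrite -big_split /=; apply: big1_seq => I /andP[_]; rewrite fpowersetE => IL.
have tI : t \notin I by apply: contra tL => /(fsubsetP IL).
rewrite cardfsU1 tI add1n exprS mulN1r mulNr.
rewrite (_ : (M `\` (t |` L) `|` (t |` I) = (M `\` L) `|` I)%fset) ?addNr //.
apply/fsetP => s; rewrite !inE; have [->|] := eqVneq s t => //=.
by rewrite (negPf tL) tM.
Qed.

Lemma tau0 theta M : tau theta M fset0 = - theta M.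
Proof.
by rewrite /tau fpowerset0 big_seq_fset1 cardfs0 expr1 fsetD0 fsetU0 mulN1r.
Qed.

(** By [tauU1], summing over the pairs that differ in one point of [B] deletes that point from both
    sets; what is left at the end is [tau theta A fset0]. *)
Lemma sum_tau_disjoint theta A B : [disjoint A & B]%fset ->
  \sum_(L <- fpowerset B) tau theta (A `|` B)%fset L = - theta A.
Proof.
elim/fset1U_rect: B => [_|t B tB IH dAB].
  by rewrite fpowerset0 big_seq_fset1 fsetU0 tau0.
rewrite big_fpowersetU1 // -IH; last first.
  by apply: fdisjointWr dAB; rewrite fsubsetU1.
apply: eq_big_seq => L; rewrite fpowersetE => LB.
have tL : t \notin L by apply: contra tB => /(fsubsetP LB).
rewrite tauU1 // ?inE ?eqxx ?orbT //.
congr tau; apply/fsetP => s; rewrite !inE; have [->|] := eqVneq s t => //=.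
rewrite (negPf tB) orbF; apply/esym/negbTE; move/fdisjointP: dAB => /(_ t) h.
by apply/negP => /h; rewrite fset1U1.
Qed.

(** The sum over all subsets of [M] is [- theta fset0 = 0], and the subsets disjoint from [A]
    contribute [- theta A]. *)
Lemma sum_tau_meet theta A M : theta fset0 = 0 -> (A `<=` M)%fset ->
  \sum_(L <- fpowerset M | ~~ [disjoint L & A]%fset) tau theta M L = theta A.
Proof.
move=> th0 AM.
have := sum_tau_disjoint theta (fdisjoint0X M); rewrite fset0U th0 oppr0.
rewrite (bigID (fun L => [disjoint L & A]%fset)) /= => /eqP.
rewrite addrC addr_eq0 => /eqP ->; apply/eqP; rewrite eqr_oppLR; apply/eqP.
rewrite -(@sum_tau_disjoint theta A (M `\` A)%fset); last first.
  by apply/fdisjointP => t tA; rewrite inE tA.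
have -> : (A `|` M `\` A = M)%fset.
  apply/fsetP => t; rewrite !inE; have [tA|//] := boolP (t \in A).
  by rewrite (fsubsetP AM).
rewrite big_fset_condE.
apply: congr_big => //; congr enum_fset; apply/fsetP => L.
by rewrite fpowersetCE !inE /= fpowersetE.
Qed.

End Moebius.

(** * The Choquet integral as a maximum of linear forms *)

Section Choquet.
Variables (R : realType) (T : choiceType).
Implicit Types (theta : {fset T} -> R) (A B K L M : {fset T}) (x y : T -> R).

(** For [x >= 0] and [theta fset0 = 0] this is the Choquet integral of [x] over [M] with respect to
    [theta]. At [1/x] it is the exponent in the TM formula. *)
Definition choquet theta M x : R :=
  \sum_(L <- fpowerset M | L != fset0)
    tau theta M L * \big[Num.max/0]_(t <- L) x t.

Lemma bigmax_seq_attained (s : seq T) x : s != [::] ->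
  {in s, forall t, 0 <= x t} ->
  exists2 t, t \in s & \big[Num.max/0]_(t <- s) x t = x t.
Proof.
elim: s => // a [|b s] IH _ x0.
  exists a; rewrite ?mem_head // big_cons big_nil; apply/max_idPl/x0; exact: mem_head.
have [t ts tE] := IH isT (fun t ts => x0 t (mem_behead (s := a :: b :: s) ts)).
rewrite big_cons tE; case: (leP (x a) (x t)) => _.
  by exists t; rewrite // inE ts orbT.
by exists a; rewrite ?mem_head.
Qed.

Lemma bigmax_fset_attained L x : L != fset0 ->
  {in L, forall t, 0 <= x t} ->
  exists2 t, t \in L & \big[Num.max/0]_(t <- L) x t = x t.
Proof.
move=> L0; apply: bigmax_seq_attained; apply: contra L0 => /eqP L0.
by apply/eqP/fsetP => t; rewrite -[t \in L]/(t \in enum_fset L) L0.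
Qed.

Lemma sum_fset_indic A M (f : T -> R) : (A `<=` M)%fset ->
  \sum_(t <- M) (t \in A)%:R * f t = \sum_(t <- A) f t.
Proof.
move=> AM; rewrite -(big_fset_incl _ AM); last by move=> t _ /negPf ->; rewrite mul0r.
by apply: eq_big_seq => t ->; rewrite mul1r.
Qed.

Lemma sum_fset_delta A s (f : T -> R) :
  \sum_(t <- A) (Some s == Some t)%:R * f t = (s \in A)%:R * f s.
Proof.
have [sA|sA] := boolP (s \in A); last first.
  rewrite mul0r; apply: big1_seq => t /andP[_ tA].
  rewrite [Some s == _](_ : _ = false) ?mul0r //.
  by apply/eqP => -[st]; rewrite st tA in sA.
rewrite (big_fsetD1 s) //= eqxx big1_seq ?addr0 // => t.
rewrite !inE => /andP[_ /andP[ts _]].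
rewrite [Some s == _](_ : _ = false) ?mul0r //.
by apply/eqP => -[st]; rewrite st eqxx in ts.
Qed.

(** If [L] meets [A], the maximum over [L] is attained in [A], as [x] vanishes on the rest of [L];
    lowering [x] by [m] on [A] then lowers it by exactly [m]. If [L] misses [A], nothing changes. *)
Lemma bigmax_sub_indic A L x m : 0 <= m ->
  {in A, forall t, m <= x t} -> {in L, forall t, t \notin A -> x t = 0} ->
  \big[Num.max/0]_(t <- L) x t =
  \big[Num.max/0]_(t <- L) (x t - (t \in A)%:R * m) +
    (~~ [disjoint L & A]%fset)%:R * m.
Proof.
move=> m0 mx xL.
have [LA|] := boolP [disjoint L & A]%fset.
  rewrite mul0r addr0; apply: eq_big_seq => t tL.
  by rewrite (negPf (fdisjointP LA t tL)) mul0r subr0.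
rewrite mul1r => /fset0Pn[u]; rewrite inE => /andP[uL uA].
have L0 : L != fset0 by apply/fset0Pn; exists u.
have x0 : {in L, forall t, 0 <= x t}.
  move=> t tL; have [tA|tA] := boolP (t \in A); first exact: le_trans (mx t tA).
  by rewrite (xL t tL tA).
have x'0 : {in L, forall t, 0 <= x t - (t \in A)%:R * m}.
  move=> t tL; have [tA|tA] := boolP (t \in A); first by rewrite mul1r subr_ge0 mx.
  by rewrite mul0r subr0 x0.
apply/le_anti/andP; split.
  have [s sL ->] := bigmax_fset_attained L0 x0.
  rewrite -lerBlDr; have [sA|sA] := boolP (s \in A).
    by apply: (bigmax_sup_seq _ s) => //; rewrite sA mul1r.
  rewrite (xL s sL sA) sub0r; apply: (@le_trans _ _ 0); first by rewrite oppr_le0.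
  exact: bigmax_ge_id.
have [s sL ->] := bigmax_fset_attained L0 x'0.
have [sA|sA] := boolP (s \in A).
  by rewrite mul1r subrK; apply: le_bigmax_seq.
(* Here the reduced maximum is 0, so it remains to find a value of [x] on [L] that is at least
   [m]. *)
rewrite mul0r subr0 (xL s sL sA) add0r.
by apply: (bigmax_sup_seq _ u) => //; exact: mx.
Qed.

(** The sets [L] whose maximum drops by [m] are those meeting [A], and their total mass is
    [theta A]. *)
Lemma choquet_sub_indic theta A M x m : theta fset0 = 0 -> (A `<=` M)%fset ->
  0 <= m -> {in A, forall t, m <= x t} ->
  {in M, forall t, t \notin A -> x t = 0} ->
  choquet theta M x =
  choquet theta M (fun t => x t - (t \in A)%:R * m) + theta A * m.
Proof.
move=> th0 AM m0 mx xM; rewrite /choquet -(sum_tau_meet th0 AM) mulr_suml.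
rewrite [X in _ + X](_ : _ = \sum_(L <- fpowerset M | L != fset0)
    tau theta M L * ((~~ [disjoint L & A]%fset)%:R * m)).
  rewrite -big_split /= big_seq_cond [RHS]big_seq_cond.
  apply: eq_bigr => L /andP[]; rewrite fpowersetE => LM _.
  rewrite -mulrDr -bigmax_sub_indic // => t /(fsubsetP LM); exact: xM.
rewrite big_mkcond [RHS]big_mkcond; apply: eq_bigr => L _.
have [->|_] := eqVneq L fset0; first by rewrite fdisjoint0X.
by case: ifP; rewrite ?mul1r ?mul0r ?mulr0.
Qed.

(* Induction on the size of the support of [x]: subtracting from [x], on its
   support, the least nonzero value of [x] shrinks the support. *)
Lemma inner_le_choquet theta M x y : theta fset0 = 0 ->
  {in M, forall t, 0 <= x t} ->
  (forall A, (A `<=` M)%fset -> \sum_(t <- A) y t <= theta A) ->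
  \sum_(t <- M) x t * y t <= choquet theta M x.
Proof.
move=> th0 + yth.
have [n] := ubnP #|` [fset t in M | x t != 0]%fset|.
elim: n x => // n IH x /[!ltnS] supp_n x0.
set A := [fset t in M | x t != 0]%fset in supp_n.
have AM : (A `<=` M)%fset by apply/fsubsetP => t; rewrite !inE => /andP[].
have xM : {in M, forall t, t \notin A -> x t = 0}.
  by move=> t tM; rewrite !inE /= tM /= negbK => /eqP.
have [A0|/fset0Pn[t0 t0A]] := eqVneq A fset0.
  rewrite big1_seq => [|t /andP[_ tM]]; last by rewrite xM ?mul0r ?A0.
  rewrite /choquet big_seq_cond big1 // => L /andP[]; rewrite fpowersetE => LM L0.
  have [t tL ->] := bigmax_fset_attained L0 (fun t tL => x0 t (fsubsetP LM t tL)).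
  by rewrite xM ?mulr0 ?A0 // (fsubsetP LM).
case: (@arg_minP _ _ _ [` t0A]%fset xpredT (fun t => x (val t))) => // t1 _ t1min.
set m := x (val t1).
have mA : {in A, forall t, m <= x t} by move=> t tA; exact: (t1min [` tA]%fset).
have m0 : 0 <= m by apply: x0; apply: (fsubsetP AM); exact: valP.
rewrite (choquet_sub_indic th0 AM m0 mA xM).
rewrite (_ : \sum_(t <- M) _ = \sum_(t <- M) (x t - (t \in A)%:R * m) * y t +
    (\sum_(t <- A) y t) * m).
  apply: lerD; last exact/ler_wpM2r/yth.
  apply: IH => [|t tM]; last first.
    have [tA|tA] := boolP (t \in A); first by rewrite mul1r subr_ge0 mA.
    by rewrite mul0r subr0 x0.
  apply: leq_trans supp_n; apply: fproper_ltn_card.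
  rewrite fproperE; apply/andP; split; [apply/fsubsetP => t|apply/fsubsetPn].
    rewrite !inE /= => /andP[->]; apply: contraNneq => xt0.
    by rewrite xt0 eqxx andbF mul0r subr0.
  (* The minimizer [t1] leaves the support. *)
  exists (val t1); first exact: valP.
  rewrite !inE /= negb_and negbK; have := valP t1; rewrite !inE /= => ->.
  by rewrite mul1r subrr eqxx orbT.
rewrite -(sum_fset_indic _ AM) mulr_suml -big_split /=; apply: eq_bigr => t _.
ring.
Qed.

(* The maximizer [c L] of [x] over [L] receives the whole mass [tau theta M L]. *)
Lemma choquet_attained theta M x : theta fset0 = 0 ->
  (forall L, (L `<=` M)%fset -> L != fset0 -> 0 <= tau theta M L) ->
  {in M, forall t, 0 <= x t} ->
  exists y, [/\ forall t, 0 <= y t, forall t, t \notin M -> y t = 0,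
    forall A, (A `<=` M)%fset -> \sum_(t <- A) y t <= theta A
    & choquet theta M x = \sum_(t <- M) x t * y t].
Proof.
move=> th0 tau0 x0.
(* Values in [option T] make [c] total even if [T] is empty; [None] is used where no maximizer is
   required. *)
have /choice [c cP] : forall L, exists o : option T, (L `<=` M)%fset -> L != fset0 ->
    exists s, [/\ o = Some s, s \in L
      & \big[Num.max/0]_(t <- L) x t = x s].
  move=> L; have [LM|_] := boolP (L `<=` M)%fset; last by exists None.
  have [->|L0] := eqVneq L fset0; first by exists None.
  have [s sL xs] := bigmax_fset_attained L0 (fun t tL => x0 t (fsubsetP LM t tL)).
  by exists (Some s) => _ _; exists s.
pose y t := \sum_(L <- fpowerset M | L != fset0) tau theta M L * (c L == Some t)%:R.
have yE A (f : T -> R) : \sum_(t <- A) f t * y t =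
    \sum_(L <- fpowerset M | L != fset0)
      tau theta M L * (\sum_(t <- A) (c L == Some t)%:R * f t).
  under eq_bigr do rewrite mulr_sumr.
  rewrite exchange_big /=; apply: eq_bigr => L _; rewrite mulr_sumr.
  apply: eq_bigr => t _; ring.
exists y; split.
- move=> t; rewrite /y big_seq_cond; apply: sumr_ge0 => L /andP[].
  by rewrite fpowersetE => LM L0; rewrite mulr_ge0 ?tau0.
- move=> t tM; rewrite /y big_seq_cond; apply: big1 => L /andP[].
  rewrite fpowersetE => LM L0; have [s [-> sL _]] := cP L LM L0.
  rewrite [Some s == _](_ : _ = false) ?mulr0 //.
  by apply/eqP => -[st]; rewrite -st (fsubsetP LM) in tM.
(* [A] receives the masses of those [L] whose chosen point lies in [A]. Such [L] meet [A], and all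
   masses are nonnegative. *)
- move=> A AM; rewrite -(sum_tau_meet th0 AM).
  under eq_bigr do rewrite -[y _]mul1r.
  rewrite yE big_seq_cond [leRHS]big_seq_cond big_mkcond [leRHS]big_mkcond /=.
  apply: ler_sum => L _; case: ifPn => [/andP[]|]; last first.
    rewrite negb_and negbK; case: ifPn => // /andP[LM LA] /orP[/negP//|/eqP L0].
    by rewrite L0 fdisjoint0X in LA.
  rewrite fpowersetE => LM L0; have [s [-> sL _]] := cP L LM L0.
  rewrite sum_fset_delta mulr1 LM /=; have [sA|_] := boolP (s \in A); last first.
    by rewrite mulr0; case: ifP => // _; exact: tau0.
  rewrite mulr1; case: ifPn => //; rewrite negbK => /fdisjointP/(_ s sL).
  by rewrite sA.
- rewrite yE /choquet big_seq_cond [RHS]big_seq_cond.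
  apply: eq_bigr => L /andP[]; rewrite fpowersetE => LM L0.
  have [s [-> sL ->]] := cP L LM L0.
  by rewrite sum_fset_delta (fsubsetP LM) // mul1r.
Qed.

End Choquet.

(** * Inclusion-exclusion for finitely many events *)

Section InclusionExclusion.
Variables (R : realType) (T : choiceType) (d : measure_display)
  (Omega : measurableType d) (P : probability Omega R).

(** The event [E] is arbitrary so that the induction hypothesis applies both to [E] and to its
    intersection with [C t]; the difference of the two results removes [C t]. *)
Lemma inclusion_exclusion (C : T -> set Omega) (L : {fset T}) (E : set Omega) :
  (forall t, measurable (C t)) -> measurable E ->
  \sum_(I <- fpowerset L)
     (-1) ^+ #|` I| * fine (P (E `&` \bigcap_(t in [set` I]) C t)) =
  fine (P (E `&` \bigcap_(t in [set` L]) ~` C t)).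
Proof.
move=> mC; elim/fset1U_rect: L E => [|t L tL IH] E mE.
  by rewrite fpowerset0 big_seq_fset1 cardfs0 expr0 mul1r !set_fset0 !bigcap_set0.
rewrite big_fpowersetU1 // big_split /= IH //.
under [X in _ + X]eq_big_seq => I.
  rewrite fpowersetE => IL.
  have tI : t \notin I by apply: contra tL => /(fsubsetP IL).
  rewrite cardfsU1 tI add1n exprS mulN1r mulNr set_fsetU1 bigcap_setU1 setIA.
  over.
rewrite sumrN IH; last exact: measurableI.
have mD : measurable (E `&` \bigcap_(s in [set` L]) ~` C s).
  apply: measurableI => //; apply: fin_bigcap_measurable => // s _; exact: measurableC.
rewrite set_fsetU1 bigcap_setU1.
have -> : E `&` (~` C t `&` \bigcap_(s in [set` L]) ~` C s) =
    (E `&` \bigcap_(s in [set` L]) ~` C s) `\` C t.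
  by rewrite setDE setIA setIAC.
have -> : E `&` C t `&` \bigcap_(s in [set` L]) ~` C s =
    (E `&` \bigcap_(s in [set` L]) ~` C s) `&` C t by rewrite setIAC.
rewrite (measureDI P mD (mC t)) fineD; first by rewrite addrK.
  by apply: fin_num_measure; exact: measurableD.
by apply: fin_num_measure; exact: measurableI.
Qed.

End InclusionExclusion.

(** * Monotonicity of an ECF and nonnegativity of its masses *)

Section ExtremalCoefficient.
Variables (R : realType) (T : choiceType) (d : measure_display)
  (Omega : measurableType d) (P : probability Omega R).
Variables (X : T -> {RV P >-> R}) (theta : {fset T} -> R).
Hypothesis ecf : is_ecf X theta.
Implicit Types (A B L M : {fset T}).

Lemma measurable_cdf_set (t : T) (x : R) : measurable [set w | X t w <= x].
Proof.
have -> : [set w | X t w <= x] = X t @^-1` `]-oo, x]%classic.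
  by apply/seteqP; split=> w /=; rewrite in_itv.
by rewrite -[X in measurable X]setTI; exact: measurable_funPT.
Qed.

Lemma measurable_joint_cdf_set A (x : R) :
  measurable (\bigcap_(t in [set` A]) [set w | X t w <= x]).
Proof.
by apply: fin_bigcap_measurable => // t _; exact: measurable_cdf_set.
Qed.

Lemma ecf_prob A (x : R) : 0 < x ->
  P (\bigcap_(t in [set` A]) [set w | X t w <= x]) = (expR (- (theta A / x)))%:E.
Proof.
move=> x0; case: ecf => th0 thA.
have [->|A0] := eqVneq A fset0.
  by rewrite set_fset0 bigcap_set0 probability_setT th0 mul0r oppr0 expR0.
have := thA A A0 x x0.
have -> : [set w | (\big[maxe/-oo]_(t <- A) (X t w)%:E <= x%:E)%E] =
    \bigcap_(t in [set` A]) [set w | X t w <= x].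
  apply/seteqP; split=> w /= Hw.
    move=> t /= tA; rewrite -lee_fin; apply: le_trans Hw.
    exact: (le_bigmax_seq _ t).
  rewrite big_seq_cond; apply: bigmax_le; first exact: leNye.
  by move=> t /andP[tA _]; rewrite lee_fin; exact: Hw.
set p := P _; have p0 : (0 <= p)%E by exact: measure_ge0.
have : p \is a fin_num.
  by apply: fin_num_measure; exact: measurable_joint_cdf_set.
move: p p0 => [p| |] //; rewrite lee_fin => p0 _.
(* A vanishing probability would make the right-hand side [+oo], while [theta A] is real. *)
have [p_gt0|] := ltP 0 p; last first.
  by move=> pneg; rewrite le0_lneNy ?lee_fin // gt0_muleNy ?lte_fin.
rewrite lne_EFin // => -[->]; congr (_%:E).
by rewrite mulNr opprK mulrAC divff ?mul1r ?lnK ?gt_eqF.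
Qed.

(** At level 1 the joint event over [B] is contained in the one over [A]. *)
Lemma ecf_le A B : (A `<=` B)%fset -> theta A <= theta B.
Proof.
move=> AB; rewrite -lerN2 -ler_expR -[theta A]divr1 -[theta B]divr1 -lee_fin.
rewrite -!ecf_prob //; apply: le_measure; rewrite ?inE.
- exact: measurable_joint_cdf_set.
- exact: measurable_joint_cdf_set.
- by move=> w Hw t tA; apply: Hw; exact: (fsubsetP AB).
Qed.

Lemma ecf_ge0 A : 0 <= theta A.
Proof. by rewrite -ecf.1; apply: ecf_le; exact: fsub0set. Qed.

(** Follows from [1 + v <= expR v], since [(1 - v + v^2) (1 + v) = 1 + v^3 >= 1]. *)
Lemma expRN_le (v : R) : 0 <= v -> expR (- v) <= 1 - v + v ^+ 2.
Proof.
move=> v0; rewrite expRN; have v1 : 0 < 1 + v by rewrite ltr_wpDr.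
apply: (@le_trans _ _ (1 + v)^-1).
  by rewrite lef_pV2 ?posrE ?expR_gt0 // expR_ge1Dx.
rewrite -[leLHS]mul1r ler_pdivrMr //.
rewrite (_ : _ * _ = 1 + v ^+ 3); last by ring.
by rewrite lerDl exprn_ge0.
Qed.

Lemma sum_sign_fpowerset L : L != fset0 ->
  \sum_(I <- fpowerset L) (-1) ^+ #|` I| = 0 :> R.
Proof.
move=> /fset0Pn[t tL]; rewrite -(fsetD1K tL).
have tL' : t \notin (L `\ t)%fset by rewrite !inE eqxx.
rewrite big_fpowersetU1 //; apply: big1_seq => I; rewrite fpowersetE /= => IL.
have tI : t \notin I by apply: contra tL' => /(fsubsetP IL).
by rewrite cardfsU1 tI add1n exprS mulN1r subrr.
Qed.

(* The inclusion-exclusion sum is nonnegative and equals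
   [u * tau theta M L + O(u^2)] as [u] tends to 0. *)
Lemma tau_ge0 M L : L != fset0 -> 0 <= tau theta M L.
Proof.
move=> L0; set K := (M `\` L)%fset.
pose D := \sum_(I <- fpowerset L) theta (K `|` I)%fset ^+ 2.
have D0 : 0 <= D by apply: sumr_ge0 => I _; exact: sqr_ge0.
suff tauD (u : R) : 0 < u -> 0 <= tau theta M L + u * D.
  (* With [u = e / (D + 1)] the error [u * D] is at most [e]; adding 1 keeps the denominator
     positive when [D = 0]. *)
  apply/ler_addgt0Pr => e e0; have u0 : 0 < e / (D + 1) by rewrite divr_gt0 ?ltr_wpDl.
  apply: le_trans (tauD _ u0) _; rewrite lerD2l mulrAC ler_pdivrMr ?ltr_wpDl //.
  by rewrite ler_wpM2l ?(ltW e0) // lerDl.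
move=> u0; rewrite -(pmulr_rge0 _ u0).
have u'0 : 0 < u^-1 by rewrite invr_gt0.
pose C t := [set w | X t w <= u^-1].
have mC t : measurable (C t) by exact: measurable_cdf_set.
have mK : measurable (\bigcap_(t in [set` K]) C t) by exact: fin_bigcap_measurable.
have : 0 <= \sum_(I <- fpowerset L)
    (-1) ^+ #|` I| *
    fine (P (\bigcap_(t in [set` K]) C t `&` \bigcap_(t in [set` I]) C t)).
  by rewrite inclusion_exclusion // fine_ge0.
move=> /le_trans; apply.
(* The constant terms cancel because [L] is nonempty, the linear ones give [tau], and the quadratic
   ones, all with sign plus, give [D]. *)
rewrite (_ : u * (tau theta M L + u * D) = \sum_(I <- fpowerset L) ((-1) ^+ #|` I| * 1 +
   (u * ((-1) ^+ #|` I|.+1 * theta (K `|` I)%fset) +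
    u ^+ 2 * theta (K `|` I)%fset ^+ 2))); last first.
  rewrite !big_split /= -mulr_suml sum_sign_fpowerset // mul0r add0r -!mulr_sumr.
  by rewrite mulrDr mulrA -expr2.
apply: ler_sum => I _.
rewrite -bigcap_setU -set_fsetU ecf_prob // invrK /=.
set th := theta _; have v0 : 0 <= th * u by rewrite mulr_ge0 ?ecf_ge0 ?ltW.
(* With [v = th * u], sets of even size need [expR (- v) <= 1 - v + v^2], those of odd size
   [1 - v <= expR (- v)]. *)
have := expRN_le v0; have := expR_ge1Dx (- (th * u)).
have : 0 <= (th * u) ^+ 2 by exact: sqr_ge0.
rewrite [(-1) ^+ _.+1]exprS -signr_odd; case: odd => /=; rewrite ?expr1 ?expr0.
  set e := expR _; nra.
set e := expR _; nra.
Qed.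
End ExtremalCoefficient.

(** * The polymatroid of [theta] is compact and convex *)

Section Polymatroid.
Variables (R : realType) (T : choiceType).
Implicit Types (theta : {fset T} -> R) (A M : {fset T}).

Definition extend0 M (y : M -> R) (t : T) : R :=
  if insub t is Some u then y u else 0.

Lemma extend0_val M (y : M -> R) (u : M) : extend0 y (val u) = y u.
Proof. by rewrite /extend0 valK. Qed.

Lemma extend0_ge0 M (y : M -> R) : nonneg_orthant y -> forall t, 0 <= extend0 y t.
Proof. by move=> y0 t; rewrite /extend0; case: insubP => // u _ _; exact: y0. Qed.

Lemma sum_extend0 M A (y : M -> R) : (A `<=` M)%fset ->
  \sum_(t <- A) extend0 y t = \sum_(t : M | val t \in A) y t.
Proof.
move=> AM; rewrite -(sum_fset_indic _ AM) big_seq_fsetE [RHS]big_mkcond /=.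
apply: eq_bigr => t _; rewrite extend0_val.
by case: ifP => _; rewrite ?mul1r ?mul0r.
Qed.

Definition polymatroid theta M : set (M -> R) :=
  [set y | nonneg_orthant y /\
    forall A, (A `<=` M)%fset -> \sum_(t : M | val t \in A) y t <= theta A].

(** The constraints at singletons confine it to a product of segments, compact by Tychonoff, in
    which it is cut out by closed conditions. *)
Lemma polymatroid_compact theta M :
  compact (polymatroid theta (M := M) : set {ptws M -> R}).
Proof.
pose box : set {ptws M -> R} :=
  [set y | forall t : M, `[0, theta [fset val t]%fset]%classic (y t)].
have box_compact : compact box.
  apply: (@tychonoff M (fun _ => R)
    (fun t => `[0, theta [fset val t]%fset]%classic)) => t.
  exact: segment_compact.
apply: (subclosed_compact _ box_compact); last first.
  move=> y [y0 yA] t /=; rewrite in_itv /= y0 /=.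
  have := yA [fset val t]%fset; rewrite fsub1set (fsvalP t) => /(_ isT).
  by under eq_bigl do rewrite inE val_eqE; rewrite big_pred1_eq.
rewrite (_ : polymatroid theta (M := M) =
    (\bigcap_(t in [set: M]) [set y : {ptws M -> R} | 0 <= y t]) `&`
    \bigcap_(A in [set A | (A `<=` M)%fset])
      [set y : {ptws M -> R} | \sum_(t : M | val t \in A) y t <= theta A]); last first.
  apply/seteqP; split=> y [y0 yA]; split=> //.
  - by move=> t _; exact: y0.
  - by move=> t; exact: y0.
have proj_cont (t : M) : continuous (fun y : {ptws M -> R} => y t).
  exact: (@proj_continuous M (fun _ => R) t).
apply: closedI; apply: closed_bigI.
  move=> t _; apply: (@preimage_closed _ _ (fun y : {ptws M -> R} => y t)
    [set x | 0 <= x]); last exact: closed_ge.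
  by move=> y _; exact: proj_cont.
move=> A _; apply: (@preimage_closed _ _
  (fun y : {ptws M -> R} => \sum_(t : M | val t \in A) y t)
  [set x | x <= theta A]); last exact: closed_le.
by move=> y _; apply: continuous_big => [|t _]; [exact: add_continuous|exact: proj_cont].
Qed.

Lemma polymatroid_convex theta M : convex_set (polymatroid theta (M := M)).
Proof.
move=> y z k /set_mem[y0 yA] /set_mem[z0 zA]; apply/mem_set.
have convE t : conv k y z t = k%:num * y t + (1 - k%:num) * z t by [].
split=> [t|A AM].
  by rewrite convE addr_ge0 // mulr_ge0 // ?y0 ?z0 // onem_ge0.
under eq_bigr do rewrite convE.
rewrite big_split /= -!mulr_sumr.
rewrite [leRHS](_ : _ = k%:num * theta A + (1 - k%:num) * theta A); last first.
  by rewrite -mulrDl addrC subrK mul1r.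
by apply: lerD; apply: ler_wpM2l; rewrite ?subr_ge0 ?yA ?zA.
Qed.

End Polymatroid.

(** * Finite-dimensional dependency sets of a TM process *)

Section TawnMolchanov.
Variables (R : realType) (T : choiceType) (theta : {fset T} -> R)
  (d : measure_display) (Omega : measurableType d) (P : probability Omega R)
  (X : T -> {RV P >-> R}).
Implicit Types (A B L M : {fset T}).
Hypothesis tm : is_TM_process X theta.

Hypothesis theta0 : theta fset0 = 0.
Hypothesis theta_le : forall A B, (A `<=` B)%fset -> theta A <= theta B.
Hypothesis tau_ge0 : forall M L, L != fset0 -> 0 <= tau theta M L.

Definition supp (M : {fset T}) (x : M -> R) : {fset T} :=
  [fset t in M | extend0 x t != 0]%fset.

Lemma supp_sub M (x : M -> R) : (supp x `<=` M)%fset.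
Proof. by apply/fsubsetP => t; rewrite !inE => /andP[]. Qed.

Lemma in_supp M (x : M -> R) (t : M) : (val t \in supp x) = (x t != 0).
Proof. by rewrite !inE /= extend0_val (fsvalP t). Qed.

Lemma suppP M (x : M -> R) t : t \in supp x -> exists2 u : M, t = val u & x u != 0.
Proof.
move=> ts; have tM := fsubsetP (supp_sub x) t ts.
by exists [` tM]%fset => //; rewrite -in_supp.
Qed.

Lemma sum_supp M (x y : M -> R) :
  \sum_(t : M) x t * y t = \sum_(t <- supp x) extend0 x t * extend0 y t.
Proof.
rewrite -(sum_fset_indic _ (supp_sub x)) big_seq_fsetE /=.
apply: eq_bigr => t _; rewrite !extend0_val in_supp.
by have [->|_] := eqVneq (x t) 0; rewrite ?mul0r ?mulr0 ?mul1r.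
Qed.

(* The formula defining a TM process only covers positive arguments; the zero
   coordinates of [x], which impose no constraint, are dropped. *)
Lemma stdf_choquet M (x : M -> R) : nonneg_orthant x ->
  stdf X x = (choquet theta (supp x) (extend0 x))%:E.
Proof.
move=> x0; rewrite /stdf.
have -> : [set w | forall t : M, ((X (val t) w)%:E <= (x t)%:E^-1)%E] =
    [set w | forall t, t \in supp x -> X t w <= (extend0 x t)^-1].
  apply/seteqP; split=> w Hw.
    move=> _ /suppP[u -> /negPf xu].
    by move: (Hw u); rewrite extend0_val inver xu lee_fin.
  move=> t; rewrite inver; have [xt|xt] := eqVneq (x t) 0; first exact: leey.
  by rewrite lee_fin -extend0_val; apply: Hw; rewrite in_supp.
have [s0|s0] := eqVneq (supp x) fset0.
  rewrite s0 [X in P X](_ : _ = setT) ?probability_setT ?lne1 ?oppe0; last first.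
    by apply/seteqP; split.
  by rewrite /choquet fpowerset0 big_mkcond big_seq_fset1 eqxx.
rewrite (tm.2 (supp x) (fun t => (extend0 x t)^-1) s0) => [|t ts].
  congr (_%:E); apply: eq_bigr => L _; congr (_ * _).
  by apply: eq_bigr => t _; rewrite invrK.
rewrite invr_gt0 lt_neqAle extend0_ge0 // andbT eq_sym.
by move: ts; rewrite !inE => /andP[].
Qed.

(** All maxima are 1 and every nonempty subset of [A] meets [A], so [sum_tau_meet] applies. *)
Lemma choquet_indic A (x : T -> R) : {in A, forall t, x t = 1} ->
  choquet theta A x = theta A.
Proof.
move=> x1; rewrite -[RHS](sum_tau_meet theta0 (fsubset_refl A)) /choquet.
rewrite big_seq_cond [RHS]big_seq_cond; apply: eq_big => L.
  rewrite fpowersetE; have [LA|//] := boolP (L `<=` A)%fset.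
  have [->|L0] := eqVneq L fset0; first by rewrite fdisjoint0X.
  rewrite /=; apply/esym/fset0Pn; case/fset0Pn: L0 => t tL.
  by exists t; rewrite inE tL (fsubsetP LA).
move=> /andP[]; rewrite fpowersetE => LA L0.
have xL t : t \in L -> x t = 1 by move=> tL; apply/x1/(fsubsetP LA).
have x0 : {in L, forall t, 0 <= x t} by move=> t tL; rewrite xL.
have [t tL ->] := bigmax_fset_attained L0 x0.
by rewrite xL ?mulr1.
Qed.

Lemma polymatroid_represents M : represents_stdf X (polymatroid theta (M := M)).
Proof.
split.
- by move=> y [].
- exact: polymatroid_compact.
- exact: polymatroid_convex.
move=> x x0; rewrite stdf_choquet //; apply/le_anti/andP; split.
  have xs0 : {in supp x, forall t, 0 <= extend0 x t}.
    by move=> t _; exact: extend0_ge0.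
  have taus0 L : (L `<=` supp x)%fset -> L != fset0 -> 0 <= tau theta (supp x) L.
    by move=> _; exact: tau_ge0.
  have [y [y0 ys yA ->]] := choquet_attained theta0 taus0 xs0.
  apply: ereal_sup_ubound; exists (fun t => y (val t)); last first.
    rewrite sum_supp; congr (_%:E); apply: eq_big_seq.
    by move=> _ /suppP[u -> _]; rewrite !extend0_val.
  split=> [t|A AM]; first exact: y0.
  (* The bounds on [y] are known only inside [supp x]. Since [y] vanishes outside, its sum over [A]
     is its sum over the intersection with [supp x], and monotonicity of [theta] concludes. *)
  have AsA : (A `&` supp x `<=` A)%fset by exact: fsubsetIl.
  apply: le_trans (theta_le AsA); apply: le_trans (yA _ (fsubsetIr _ _)).
  rewrite -(sum_extend0 _ AM) -[leRHS](_ : \sum_(t <- A) y t = _).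
    rewrite le_eqVlt; apply/orP; left; apply/eqP.
    apply: eq_big_seq => t tA; have tM := fsubsetP AM t tA.
    by rewrite -[t]/(val [` tM]%fset) extend0_val.
  rewrite -(big_fset_incl _ AsA) // => t tA; rewrite inE tA /=; exact: ys.
apply: ge_ereal_sup => _ [y [y0 yA] <-]; rewrite lee_fin sum_supp.
apply: inner_le_choquet => // [t _|A As]; first exact: extend0_ge0.
have AM := fsubset_trans As (supp_sub x).
by rewrite sum_extend0 // yA.
Qed.

(** The support function of [K] at the indicator of [A] bounds the sum over [A] of every point of
    [K], and equals [theta A] there. *)
Lemma represents_sub_polymatroid M (K : set (M -> R)) :
  represents_stdf X K -> K `<=` polymatroid theta (M := M).
Proof.
move=> [Knonneg _ _ Ksup] y Ky; split=> [|A AM]; first exact: Knonneg.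
pose x (t : M) : R := (val t \in A)%:R.
have x0 : nonneg_orthant x by move=> t; exact: ler0n.
have sA : supp x = A.
  apply/fsetP => t; have [tM|tM] := boolP (t \in M).
    by rewrite -[t]/(val [` tM]%fset) in_supp /x pnatr_eq0 eqb0 negbK.
  rewrite !inE /= (negPf tM); apply/esym; apply: contraNF tM; exact: (fsubsetP AM).
have := Ksup x x0; rewrite stdf_choquet // sA choquet_indic; last first.
  move=> t tA; have tM := fsubsetP AM t tA.
  by rewrite -[t]/(val [` tM]%fset) extend0_val /x tA.
move=> thA; rewrite -lee_fin thA; apply: ereal_sup_ubound; exists y => //.
rewrite [in RHS]big_mkcond; congr (_%:E); apply: eq_bigr => t _.
by rewrite /x; case: ifP; rewrite ?mul1r ?mul0r.
Qed.

Lemma findim_dependency_set_TM M :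
  findim_dependency_set X (M := M) = polymatroid theta (M := M).
Proof.
(* The description is definite: two largest representing sets contain each other. *)
apply: xget_subset1 => [|K K' [KX Kmax] [K'X K'max]].
  by split; [exact: polymatroid_represents|exact: represents_sub_polymatroid].
by apply/seteqP; split; [exact: K'max|exact: Kmax].
Qed.

End TawnMolchanov.

(** * From finite index sets to the whole of [T] *)

Theorem theorem32 (R : realType) (T : choiceType) (theta : {fset T} -> R)
    (d : measure_display) (Omega : measurableType d) (P : probability Omega R)
    (X : T -> {RV P >-> R})
    (d' : measure_display) (Omega' : measurableType d')
    (P' : probability Omega' R) (Xstar : T -> {RV P' >-> R})
    (hX : simple_max_stable X) (htheta : is_ecf X theta)
    (hXstar : is_TM_process Xstar theta) :
  dependency_set Xstar =
  \bigcap_(A in [set A : {fset T} | A != fset0])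
     [set x : T -> R | @nonneg_orthant R T x /\ \sum_(t <- A) x t <= theta A].
Proof.
have th0 := htheta.1.
(* Monotonicity and nonnegative masses come from [X], whose ECF is [theta]; [Xstar] contributes the
   TM formula. *)
have KE := findim_dependency_set_TM hXstar th0 (ecf_le htheta) (tau_ge0 htheta).
apply/seteqP; split=> x.
  (* The constraint at [A] is read off from the projection to [M = A]. *)
  move=> [x0 xK] A A0; split=> //; have := xK A A0; rewrite /preimage /= KE => -[_].
  move=> /(_ A (fsubset_refl A)); rewrite big_seq_fsetE /=; apply: le_trans.
  rewrite le_eqVlt; apply/orP; left; apply/eqP.
  by apply: eq_bigl => t; rewrite (fsvalP t).
move=> xA; have x0 : nonneg_orthant x.
  (* Nonnegativity at [t] is taken from the member of the intersection indexed by the singleton of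
     [t]. *)
  move=> t; have [] := xA [fset t]%fset; last by move=> + _; apply.
  by apply/fset0Pn; exists t; rewrite inE.
split=> // M M0; rewrite /preimage /= KE; split=> [t|A AM]; first exact: x0.
rewrite /coord_proj -(big_seq_fsetE _ M (fun t => t \in A)).
(* The polymatroid also has a constraint at the empty set, which reads [0 <= theta fset0]. *)
have [->|A0] := eqVneq A fset0.
  by rewrite th0 big_pred0 // => t; rewrite inE.
have [_] := xA A A0; apply: le_trans.
rewrite -(sum_fset_indic _ AM) le_eqVlt; apply/orP; left; apply/eqP.
by rewrite big_mkcond; apply: eq_bigr => t _; case: ifP; rewrite ?mul1r ?mul0r.
Qed.
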